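(* Let $k\geq 2$ be an integer and let $T$ be a tree with $n\geq 3$ vertices. Then $$\gamma_k(T)\leq \begin{cases}\frac{3k+1}{8}n & \text{if } k \text{ is odd},\\ \frac{3k}{8}n & \text{if } k \text{ is even};\end{cases}\qquad \gamma_k^s(T)\leq \begin{cases}\frac{3k+1}{8}n & \text{if } k \text{ is odd},\\ \frac{2k}{5}n & \text{if } k\in\{2,4,6\},\\ \frac{3k}{8}n & \text{if } k\geq 8 \text{ and } k \text{ is even}.\end{cases}$$
   Context: Let $G=(V,E)$ be a finite simple graph and $k$ a positive integer. For a vertex $u$, $N_G(u)$ is its open neighbourhood and $N_G[u]=N_G(u)\cup\{u\}$. For $f:V\to\{0,1,\dots,k\}$ let $w(f)=\sum_{v\in V}f(v)$. $f$ is a Roman $k$-dominating function ($k$-RDF) if every $u$ with $f(u)<k/2$ satisfies $\sum_{v\in N_G[u]}f(v)\geq k$; it is a strong Roman $k$-dominating function ($k$-SRDF) if every $u$ with $f(u)<k/2$ satisfies $f(u)+\sum_{v\in N_G(u),\, f(v)>k/2}f(v)\geq k$. $\gamma_k(G)$ (resp. $\gamma_k^s(G)$) is the minimum weight of a $k$-RDF (resp. $k$-SRDF) of $G$. *)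

(* Defs.v *)
From mathcomp Require Import all_boot.

Set Implicit Arguments.
Unset Strict Implicit.
Unset Printing Implicit Defensive.

Section Graph.
Variables (V : finType) (adj : rel V).

Definition simple_graph : Prop := symmetric adj /\ irreflexive adj.

Definition connected_graph : Prop :=
  0 < #|V| /\ forall x y : V, connect adj x y.

(* The size bound is needed because an edge u - v makes [:: u; v] a [ucycle]. *)
Definition acyclic_graph : Prop :=
  forall c : seq V, 2 < size c -> ~ ucycle adj c.

Definition tree : Prop :=
  [/\ simple_graph, connected_graph & acyclic_graph].

Definition open_nbh (u : V) : {set V} := [set v | adj u v].
Definition closed_nbh (u : V) : {set V} := u |: open_nbh u.

Variable k : nat.
Implicit Type f : {ffun V -> 'I_k.+1}.

Definition weight f : nat := \sum_(v : V) f v.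

(* The real comparisons f u < k/2 and f v > k/2 are written with the factor 2
   cleared, since k./2 on nat would round down. *)
Definition kRDF f : bool :=
  [forall u : V, (2 * f u < k) ==> (k <= \sum_(v in closed_nbh u) f v)].

Definition kSRDF f : bool :=
  [forall u : V, (2 * f u < k) ==>
     (k <= f u + \sum_(v in open_nbh u | k < 2 * f v) f v)].

Definition full_fun : {ffun V -> 'I_k.+1} := [ffun=> ord_max].

Lemma full_fun_kRDF : kRDF full_fun.
Proof.
by apply/forallP=> u; rewrite ffunE /= mul2n -addnn ltnNge leq_addr.
Qed.

Lemma full_fun_kSRDF : kSRDF full_fun.
Proof.
by apply/forallP=> u; rewrite ffunE /= mul2n -addnn ltnNge leq_addr.
Qed.

(* [full_fun] only witnesses that the minimum ranges over a nonempty set. *)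
Definition gamma : nat := weight [arg min_(f < full_fun | kRDF f) weight f].
Definition gamma_s : nat := weight [arg min_(f < full_fun | kSRDF f) weight f].

Lemma gammaP :
  (exists2 f, kRDF f & weight f = gamma) /\
  (forall f, kRDF f -> gamma <= weight f).
Proof.
rewrite /gamma; case: arg_minnP => [|f fP fmin]; first exact: full_fun_kRDF.
by split=> //; exists f.
Qed.

Lemma gamma_sP :
  (exists2 f, kSRDF f & weight f = gamma_s) /\
  (forall f, kSRDF f -> gamma_s <= weight f).
Proof.
rewrite /gamma_s; case: arg_minnP => [|f fP fmin]; first exact: full_fun_kSRDF.
by split=> //; exists f.
Qed.

End Graph.

(* Main.v *)
(* A spider is a vertex (the centre) with p pendant leaves and q pendant paths
   of length 2, where p + q >= 2. The vertices of a connected graph on at least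
   three vertices can be partitioned into spanning sets of spiders: start from a
   path on three vertices and repeatedly add a vertex v adjacent to a covered
   vertex w; either v extends the spider of w, or that spider together with v is
   again one spider or splits into two. Roman domination survives adding edges,
   so it suffices to treat each spider. There, either the centre gets k and the
   ends of the q legs get k/2 rounded up, or, when p = 0, the centre and the leg
   ends all get the same value a, about k/2 (strictly above k/2 in the strong
   version). In every case one of the two has the required weight. *)
Require Import Defs.
From mathcomp Require Import all_boot all_order all_algebra.
From mathcomp Require Import zify ring.

Import Order.TTheory GRing.Theory Num.Theory.

Lemma uphalf_bounds k : uphalf k <= k <= 2 * uphalf k.
Proof. lia. Qed.

(** * Partition of a connected graph into spiders *)

Section SpiderCover.

Context {V : finType} (adj : rel V).
Hypothesis adj_sym : symmetric adj.

(* (c, L, P) encodes the spider with centre c, a pendant leaf l for each l in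
   L and a pendant path c - x - y for each (x, y) in P. *)
Definition spider : Type := V * seq V * seq (V * V).

Definition spider_vertices (S : spider) : seq V :=
  let: (c, L, P) := S in c :: L ++ unzip1 P ++ unzip2 P.

Definition is_spider (S : spider) : bool :=
  let: (c, L, P) := S in
  [&& all (adj c) L, all (fun e => adj c e.1 && adj e.1 e.2) P
    & 1 < size L + size P].

Definition spiders_vertices (D : seq spider) : seq V :=
  flatten (map spider_vertices D).

(** By the position of [w]: a centre gains the leaf [v]; a leaf becomes a leg through [w] to [v]; a
    leg containing [w] forms with [v] a path on three vertices, which is cut off when the rest can
    stand alone. *)
Lemma spider_extend S w v :
  is_spider S -> w \in spider_vertices S -> adj w v ->
  exists2 D, all is_spider D &
    perm_eq (spiders_vertices D) (v :: spider_vertices S).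
Proof.
case: S => [[c L] P] /= /and3P[cL cP LP] wS wv.
have leg_case x y : (x, y) \in P -> w = x \/ w = y ->
  exists2 D, all is_spider D &
    perm_eq (spiders_vertices D) [:: v, c & L ++ unzip1 P ++ unzip2 P].
  move=> /perm_to_rem pP wxy.
  move: (rem _ P) pP => P' pP.
  have /=/andP[/andP[cx xy] cP'] : all (fun e => adj c e.1 && adj e.1 e.2) ((x, y) :: P').
    by rewrite -(perm_all _ pP).
  have {}LP : 0 < size L + size P'.
    by move: LP; rewrite (perm_size pP) /= addnS ltnS.
  suff [D okD pD] : exists2 D, all is_spider D & perm_eq (spiders_vertices D)
      [:: v, x, y, c & L ++ unzip1 P' ++ unzip2 P'].
    exists D => //; apply: (perm_trans pD).
    apply/permP => a /=; rewrite !count_cat.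
    rewrite (permP (perm_map fst pP) a) (permP (perm_map snd pP) a) /=; ring.
  have [D1 okD1 pD1] : exists2 D1, all is_spider D1 &
      perm_eq (spiders_vertices D1) [:: v; x; y].
    case: wxy wv => -> wv;
      [exists [:: (x, [:: v; y], [::])] | exists [:: (y, [:: v; x], [::])]];
      rewrite /= ?wv ?xy ?(adj_sym y x) ?xy //;
      apply/permP => a; rewrite /spiders_vertices /=; ring.
  have split_leg : (exists2 D2, all is_spider D2 & perm_eq (spiders_vertices D2)
      (c :: L ++ unzip1 P' ++ unzip2 P')) -> exists2 D, all is_spider D &
      perm_eq (spiders_vertices D) [:: v, x, y, c & L ++ unzip1 P' ++ unzip2 P'].
    case=> D2 ok2 p2; exists (D1 ++ D2); first by rewrite all_cat okD1.
    by rewrite /spiders_vertices map_cat flatten_cat; exact: (perm_cat pD1 p2).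
  (* With two leaves or legs left, the rest is a spider with the same centre; otherwise exactly one
     is left. *)
  have [LP2|LP2] := ltnP 1 (size L + size P').
    apply: split_leg; exists [:: (c, L, P')]; first by rewrite /= cL cP' LP2.
    by rewrite /spiders_vertices /= cats0.
  (* If a leg is left, it forms with [c] a spider centred at [x']. If a leaf [l] is left, [c] and
     [l] are too few for a spider, so all five vertices form one spider, centred at [x]. *)
  case: L P' cL cP' LP LP2 {pP cP wS} split_leg => [|l [|? ?]] [|[x' y'] [|? ?]] //=; rewrite ?addnS //.
  - rewrite !andbT => _ /andP[cx' xy'] _ _; apply.
    exists [:: (x', [:: c; y'], [::])]; first by rewrite /= adj_sym cx' xy'.
    by apply/permP => a; rewrite /spiders_vertices /=; ring.
  - rewrite andbT => cl _ _ _ _.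
    case: wxy wv => -> wv;
      [exists [:: (x, [:: v; y], [:: (c, l)])] | exists [:: (x, [::], [:: (y, v); (c, l)])]];
      rewrite /= ?wv ?xy ?(adj_sym x c) ?cx ?cl //;
      apply/permP => a; rewrite /spiders_vertices /=; ring.
move: wS; rewrite !inE !mem_cat => /or4P[/eqP wc|wL|wP|wP].
- exists [:: (c, v :: L, P)]; first by rewrite /= -{1}wc wv cL cP; lia.
  by apply/permP => a /=; rewrite cats0; ring.
- have pL := perm_to_rem wL; move: (rem w L) pL => L' pL.
  exists [:: (c, L', (w, v) :: P)].
    have /=/andP[cw cL'] : all (adj c) (w :: L') by rewrite -(perm_all _ pL).
    by rewrite /= cw wv cL' cP /= andbT; move: LP; rewrite (perm_size pL) /=; lia.
  by apply/permP => a /=; rewrite cats0 !count_cat /= !count_cat (permP pL a) /=; ring.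
- case/mapP: wP => -[x y] xyP wE.
  by apply: (leg_case x y xyP); left.
- case/mapP: wP => -[x y] xyP wE.
  by apply: (leg_case x y xyP); right.
Qed.


Lemma spider_cover :
  (forall x y, connect adj x y) -> 2 < #|V| ->
  exists D, [/\ all is_spider D, uniq (spiders_vertices D)
    & spiders_vertices D =i V].
Proof.
move=> conn n_ge3.
(* By connectivity, a nonempty set that no edge leaves is all of [V]. *)
have grow s : uniq s -> 0 < size s < #|V| ->
    exists w v, [/\ w \in s, v \notin s & adj w v].
  move=> us /andP[s_gt0 sV].
  have [/existsP[w /existsP[v /and3P[ws vs wv]]]|noedge] :=
    boolP [exists w, exists v, [&& w \in s, v \notin s & adj w v]].
    by exists w, v.
  have sE : s =i predT.
    case: s s_gt0 us sV noedge => [//|x s] _ us sV noedge y.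
    have clos : closed adj [in x :: s].
      apply: intro_closed => [|w v wv ws]; first exact: sym_connect_sym.
      apply: contraNT noedge => vs.
      by apply/existsP; exists w; apply/existsP; exists v; apply/and3P.
    by have := closed_connect clos (conn x y); rewrite !inE eqxx.
  by move: sV; rewrite -(card_uniqP us) (eq_card sE) ltnn.
(* Induction on the number [m] of covered vertices, starting from a path on three vertices. *)
have cover m : 2 < m <= #|V| -> exists D,
    [/\ all is_spider D, uniq (spiders_vertices D) & size (spiders_vertices D) = m].
  elim: m => [//|m IHm] /andP[m_ge3 mV].
  have [m2|m2] := ltnP 2 m; last first.
    have /card_gt0P[x _] : 0 < #|V| by apply: leq_trans n_ge3.
    have [|? [y []]] := grow [:: x] isT; first exact: ltnW n_ge3.
    rewrite !inE => /eqP-> yx xy.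
    have uxy : uniq [:: x; y] by rewrite /= inE eq_sym yx.
    have [|w [v []]] := grow [:: x; y] uxy; first exact: n_ge3.
    rewrite !inE negb_or => wxy /andP[vx vy] wv.
    exists [:: if w == x then (x, [:: v; y], [::]) else (y, [:: v; x], [::])].
    have -> : m = 2 by lia.
    case: eqP wxy => [wx _|_ /= /eqP wy]; rewrite /= !inE !andbT !negb_or.
      by rewrite -{1}wx wv xy vy !(eq_sym x) vx yx.
    by rewrite -{1}wy wv adj_sym xy yx vx eq_sym vy.
  have [|D [okD uD sD]] := IHm; first by rewrite m2 ltnW.
  have [|w [v [wD vD wv]]] := grow _ uD; first by rewrite sD mV (ltn_trans _ m2).
  have /flattenP[_ /mapP[S SD ->] wS] := wD.
  have pD := perm_to_rem SD.
  have pV : perm_eq (spiders_vertices D) (spider_vertices S ++ spiders_vertices (rem S D)).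
    exact: (perm_flatten (perm_map spider_vertices pD)).
  have /=/andP[okS okD'] : all is_spider (S :: rem S D) by rewrite -(perm_all _ pD).
  have [D2 ok2 p2] := spider_extend _ _ _ okS wS wv.
  have p : perm_eq (spiders_vertices (D2 ++ rem S D)) (v :: spiders_vertices D).
    rewrite /spiders_vertices map_cat flatten_cat.
    apply: perm_trans (perm_cat p2 (perm_refl _)) _.
    by rewrite /= perm_cons perm_sym.
  exists (D2 ++ rem S D); rewrite all_cat ok2 okD' (perm_uniq p) (perm_size p) /=.
  by rewrite vD uD sD.
have [|D [okD uD sD]] := cover #|V|; first by rewrite n_ge3 leqnn.
exists D; split=> // x; rewrite inE.
have : spiders_vertices D =i enum V.
  have sub : {subset spiders_vertices D <= enum V} by move=> y _; rewrite mem_enum.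
  by have [|] := uniq_min_size uD sub; first by rewrite sD cardE.
by move=> ->; rewrite mem_enum.
Qed.

End SpiderCover.

(** * Dominating functions on spiders and on their disjoint unions *)

Section Domination.

Context {V : finType} (adj : rel V) (k t : nat).

(* t is the least value that counts towards the neighbours: t = 0 gives Roman
   k-domination and t = k./2.+1 strong Roman k-domination. *)
Definition dominating (s : seq V) (f : V -> nat) : Prop :=
  forall u, u \in s -> f u <= k /\ (2 * f u < k ->
    k <= f u + \sum_(v | [&& v \in s, adj u v & t <= f v]) f v).

(** [dominating] counts only neighbours inside its list, so enlarging the list cannot decrease the
    sums; disjointness keeps the values of [f2] on [s2]. *)
Lemma dominating_cat s1 s2 f1 f2 : uniq (s1 ++ s2) ->
  dominating s1 f1 -> dominating s2 f2 ->
  dominating (s1 ++ s2) (fun u => if u \in s1 then f1 u else f2 u).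
Proof.
rewrite cat_uniq => /and3P[_ /hasPn s12 _] dom1 dom2 u; rewrite mem_cat.
have [u1 _|_ /= u2] := boolP (u \in s1).
  have [fk dom] := dom1 u u1; split=> // /dom /leq_trans; apply.
  rewrite leq_add2l big_mkcond [leqRHS]big_mkcond /=; apply: leq_sum => v _.
  by rewrite mem_cat; case: (v \in s1).
have [fk dom] := dom2 u u2; split=> // /dom /leq_trans; apply.
rewrite leq_add2l big_mkcond [leqRHS]big_mkcond /=; apply: leq_sum => v _.
rewrite mem_cat; have [v2|//] := boolP (v \in s2).
by rewrite (negbTE (s12 v v2)).
Qed.

(** The target weight per vertex is [num / den]. For [p] leaves and [q] legs, the alternatives of
    the last hypothesis bound the labelling with [k] at the centre and the one with [a],
    respectively. *)
Lemma spider_dominating (a num den : nat) (S : spider) :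
  symmetric adj -> is_spider adj S -> uniq (spider_vertices S) ->
  t <= a <= k -> k <= 2 * a ->
  (forall p q, 1 < p + q ->
     den * (k + q * uphalf k) <= num * (1 + p + 2 * q) \/
     p = 0 /\ den * (q.+1 * a) <= num * (1 + 2 * q)) ->
  exists2 f, dominating (spider_vertices S) f &
    den * (\sum_(u <- spider_vertices S) f u) <= num * size (spider_vertices S).
Proof.
case: S => [[c L] P] adj_sym /and3P[cL cP LP] uS /andP[ta ak] ka cost.
have tk : t <= k := leq_trans ta ak.
have /andP[hk kh] := uphalf_bounds k.
have size_S : size (spider_vertices (c, L, P)) = 1 + size L + 2 * size P.
  by rewrite /= !size_cat !size_map; lia.
move: uS; rewrite size_S [spider_vertices _]/= cons_uniq !mem_cat !negb_or !cat_uniq.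
case/andP=> /and3P[cNL cNX cNY] /and3P[uL LNXY /and3P[uX /hasPn XNY uY]].
have LNY u : u \in L -> u \notin unzip2 P.
  move=> uL'; apply: contra LNXY => uY'; apply/hasP; exists u => //.
  by rewrite mem_cat uY' orbT.
have XNY' u : u \in unzip1 P -> u \notin unzip2 P.
  by move=> uX'; apply/negP => /XNY; rewrite uX'.
have neqc (s : seq V) u : c \notin s -> u \in s -> (u == c) = false.
  by move=> cs us; apply: contraNF cs => /eqP <-.
have c1 : c \in c :: L ++ unzip1 P ++ unzip2 P by rewrite inE eqxx.
have sum_const (f : V -> nat) b (s : seq V) :
    {in s, forall u, f u = b} -> \sum_(u <- s) f u = size s * b.
  move=> fb; rewrite (eq_big_seq (fun=> b)) // big_const_seq count_predT iter_addn_0.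
  exact: mulnC.
have [cost1|[L0 cost2]] := cost _ _ LP.
  (* Only leaves and middles of legs need checking: they are adjacent to the centre, whose value [k]
     counts because [t <= k]. *)
  exists (fun u => if u == c then k else if u \in unzip2 P then uphalf k else 0).
    move=> u uS; split; first by case: ifP => // _; case: ifP.
    have [_|uc] := eqVneq u c; first by rewrite ltnNge leq_pmull.
    case: ifP => uY'; first by rewrite ltnNge kh.
    have uc' : adj u c.
      move: uS; rewrite inE (negbTE uc) !mem_cat uY' orbF /= adj_sym => /orP[/(allP cL)//|].
      by case/mapP => e /(allP cP) /andP[ce _] ->.
    by move=> _; rewrite (bigD1 c) /= ?c1 ?uc' eqxx // leq_addr.
  apply: leq_trans cost1; rewrite leq_mul2l big_cons !big_cat /= eqxx; apply/orP; right.
  rewrite (sum_const _ 0) ?(sum_const _ 0 (unzip1 P)) ?(sum_const _ (uphalf k) (unzip2 P)).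
  - by rewrite !size_map !muln0.
  - by move=> u uY' /=; rewrite (neqc _ _ cNY uY') uY'.
  - by move=> u uX' /=; rewrite (neqc _ _ cNX uX') (negbTE (XNY' u uX')).
  - by move=> u uL' /=; rewrite (neqc _ _ cNL uL') (negbTE (LNY u uL')).
case: L L0 {cL LP cNL uL LNXY LNY size_S} c1 => // _ c1.
(* Without leaves, only the middles of legs need checking: the centre and the leg end both count
   because [t <= a], and give [2 * a >= k]. *)
exists (fun u => if (u == c) || (u \in unzip2 P) then a else 0).
  move=> u uS; split; first by case: ifP.
  case: ifP => [_|]; first by rewrite ltnNge ka.
  move=> /norP[uc uY'] _.
  move: uS; rewrite inE (negbTE uc) /= mem_cat (negbTE uY') orbF.
  case/mapP => -[x y] xyP /= ux; subst u.
  have /andP[/= cx xy] := allP cP _ xyP.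
  have yY : y \in unzip2 P by apply/mapP; exists (x, y).
  rewrite (bigD1 c) /= ?c1 1?adj_sym ?cx ?eqxx // (bigD1 y) /=.
    by rewrite yY orbT add0n addnA (leq_trans ka) // mul2n -addnn leq_addr.
  by rewrite inE /= mem_cat yY !orbT xy ta (neqc _ _ cNY yY).
apply: leq_trans cost2; rewrite leq_mul2l /= big_cons big_cat /= eqxx; apply/orP; right.
rewrite (sum_const _ 0 (unzip1 P)) ?(sum_const _ a (unzip2 P)).
- by rewrite !size_map muln0.
- by move=> u uY' /=; rewrite uY' orbT.
- by move=> u uX' /=; rewrite (neqc _ _ cNX uX') (negbTE (XNY' u uX')).
Qed.

Lemma spiders_dominating (a num den : nat) (D : seq spider) :
  symmetric adj -> all (is_spider adj) D -> uniq (spiders_vertices D) ->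
  t <= a <= k -> k <= 2 * a ->
  (forall p q, 1 < p + q ->
     den * (k + q * uphalf k) <= num * (1 + p + 2 * q) \/
     p = 0 /\ den * (q.+1 * a) <= num * (1 + 2 * q)) ->
  exists2 f, dominating (spiders_vertices D) f &
    den * (\sum_(u <- spiders_vertices D) f u) <= num * size (spiders_vertices D).
Proof.
move=> adj_sym okD uD tak ka cost; elim: D okD uD => [_ _|S D IHD].
  by exists (fun=> 0) => //; rewrite big_nil muln0.
rewrite /= -/(spiders_vertices D) => /andP[okS okD] u12.
have := u12; rewrite cat_uniq => /and3P[uS /hasPn SD uD].
have [f1 dom1 le1] := spider_dominating _ _ _ _ adj_sym okS uS tak ka cost.
have [f2 dom2 le2] := IHD okD uD.
exists (fun u => if u \in spider_vertices S then f1 u else f2 u).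
  exact: dominating_cat.
rewrite big_cat size_cat !mulnDr /=; apply: leq_add.
  by rewrite (eq_big_seq f1) // => u ->.
by rewrite (eq_big_seq f2) // => u /SD /negbTE ->.
Qed.

End Domination.

(** * From spiders to [gamma] and [gamma_s], with the cost inequalities by parity of [k] *)

Lemma connected_dominating (V : finType) (adj : rel V) (k t a num den : nat) :
  symmetric adj -> (forall x y, connect adj x y) -> 2 < #|V| ->
  t <= a <= k -> k <= 2 * a ->
  (forall p q, 1 < p + q ->
     den * (k + q * uphalf k) <= num * (1 + p + 2 * q) \/
     p = 0 /\ den * (q.+1 * a) <= num * (1 + 2 * q)) ->
  exists2 f : {ffun V -> 'I_k.+1},
    forall u, 2 * f u < k -> k <= f u + \sum_(v | adj u v && (t <= f v)) f v &
    den * weight f <= num * #|V|.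
Proof.
move=> adj_sym conn n_ge3 tak ka cost.
have [D [okD uD sD]] := spider_cover adj adj_sym conn n_ge3.
have [f dom le] := spiders_dominating _ _ _ _ _ _ _ adj_sym okD uD tak ka cost.
(* [dominating] bounds the values by [k], so [inord] preserves them. *)
have fE u : @inord k (f u) = f u :> nat.
  by rewrite inordK // ltnS; have [] := dom u; rewrite ?sD.
exists [ffun u => inord (f u)].
  move=> u; rewrite ffunE fE => fu; have [|_ /(_ fu)] := dom u; first by rewrite sD.
  congr (_ <= _ + _); apply: eq_big => [v|v _]; last by rewrite ffunE fE.
  by rewrite sD ffunE fE.
move: le; rewrite -(card_uniqP uD) (eq_card sD) => /(leq_trans _); apply.
rewrite leq_mul2l big_uniq //= /weight; apply/orP; right.
rewrite [leqRHS](eq_bigl predT) => [|u]; last by rewrite sD.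
by apply: leq_sum => u _; rewrite ffunE fE.
Qed.


(** With [t = 0] every neighbour counts, so [a] can be [uphalf k], the least value with
    [k <= 2 * a]. *)
Lemma gamma_bound (V : finType) (adj : rel V) (k num den : nat) :
  tree adj -> 2 < #|V| ->
  (forall p q, 1 < p + q ->
     den * (k + q * uphalf k) <= num * (1 + p + 2 * q) \/
     p = 0 /\ den * (q.+1 * uphalf k) <= num * (1 + 2 * q)) ->
  den * gamma adj k <= num * #|V|.
Proof.
move=> [[adj_sym adj_irr] [_ conn] _] n_ge3 cost.
have /andP[hk kh] := uphalf_bounds k.
have [f dom le] := connected_dominating _ _ k 0 _ _ _ adj_sym conn n_ge3 hk kh cost.
apply: leq_trans le; rewrite leq_mul2l; apply/orP; right.
apply: (gammaP adj k).2; apply/forallP => u; apply/implyP => /dom.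
rewrite /closed_nbh big_setU1 /=; last by rewrite inE adj_irr.
by congr (_ <= _ + _); apply: eq_bigl => v; rewrite inE andbT.
Qed.

(** Here [t = a = k./2.+1], the least integer strictly above k/2; [0 < k] makes it at most [k]. *)
Lemma gamma_s_bound (V : finType) (adj : rel V) (k num den : nat) :
  0 < k -> tree adj -> 2 < #|V| ->
  (forall p q, 1 < p + q ->
     den * (k + q * uphalf k) <= num * (1 + p + 2 * q) \/
     p = 0 /\ den * (q.+1 * k./2.+1) <= num * (1 + 2 * q)) ->
  den * gamma_s adj k <= num * #|V|.
Proof.
move=> k_gt0 [[adj_sym adj_irr] [_ conn] _] n_ge3 cost.
have tE x : (k./2 < x) = (k < 2 * x) by clear -k; lia.
have [||f dom le] := connected_dominating _ _ k k./2.+1 k./2.+1 _ _ adj_sym conn n_ge3 _ _ cost.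
- by clear -k_gt0; lia.
- by clear -k; lia.
apply: leq_trans le; rewrite leq_mul2l; apply/orP; right.
apply: (gamma_sP adj k).2; apply/forallP => u; apply/implyP => /dom.
by congr (_ <= _ + _); apply: eq_bigl => v; rewrite inE tE.
Qed.

(** For odd [k], [uphalf k] and [k./2.+1] are both [m.+1], so this serves [gamma] and [gamma_s]
    alike. The left inequality is an equality at [p = q = 1]. *)
Lemma odd_cost m p q : 0 < m -> 1 < p + q ->
  let k := m.*2.+1 in
  8 * (k + q * m.+1) <= (3 * k + 1) * (1 + p + 2 * q) \/
  p = 0 /\ 8 * (q.+1 * m.+1) <= (3 * k + 1) * (1 + 2 * q).
Proof.
move=> m_gt0 pq k; rewrite /k.
by case: (posnP p) pq => [->|p_gt0] pq; [right; split=> //; nia | left; nia].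
Qed.

Lemma even_cost m p q : 1 < p + q ->
  8 * (m.*2 + q * m) <= 3 * m.*2 * (1 + p + 2 * q) \/
  p = 0 /\ 8 * (q.+1 * m) <= 3 * m.*2 * (1 + 2 * q).
Proof.
by case: (posnP p) => [->|p_gt0] pq; [right; split=> //; nia | left; nia].
Qed.

(** At [p = 0], [q = 2] the second labelling needs [24 * m.+1 <= 30 * m], whence [3 < m], that is
    [k >= 8]. *)
Lemma even_strong_cost m p q : 3 < m -> 1 < p + q ->
  8 * (m.*2 + q * m) <= 3 * m.*2 * (1 + p + 2 * q) \/
  p = 0 /\ 8 * (q.+1 * m.+1) <= 3 * m.*2 * (1 + 2 * q).
Proof.
move=> m_gt3.
by case: (posnP p) => [->|p_gt0] pq; [right; split=> //; nia | left; nia].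
Qed.

(** The labelling with [k] at the centre meets the ratio 2k/5 on every spider, with equality at
    [p = 0], [q = 2]. *)
Lemma roman_cost m p q : 1 < p + q ->
  5 * (m.*2 + q * m) <= 2 * m.*2 * (1 + p + 2 * q).
Proof. move=> pq; nia. Qed.

Lemma ler_rat_ratio (g num den n : nat) : 0 < den -> den * g <= num * n ->
  (g%:R <= num%:R / den%:R * n%:R :> rat)%R.
Proof.
move=> den_gt0 le; rewrite mulrAC ler_pdivlMr ?ltr0n // -!natrM ler_nat.
by rewrite mulnC.
Qed.

Local Open Scope ring_scope.

Theorem theorem3p1 (k : nat) (V : finType) (adj : rel V)
    (k_ge2 : (2 <= k)%N) (treeV : tree adj) (n_ge3 : (3 <= #|V|)%N) :
  ((odd k -> (gamma adj k)%:R <= (3 * k%:R + 1) / 8 * #|V|%:R :> rat) /\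
   (~~ odd k -> (gamma adj k)%:R <= 3 * k%:R / 8 * #|V|%:R :> rat)) /\
  [/\ odd k -> (gamma_s adj k)%:R <= (3 * k%:R + 1) / 8 * #|V|%:R :> rat,
      k \in [:: 2; 4; 6]%N ->
        (gamma_s adj k)%:R <= 2 * k%:R / 5 * #|V|%:R :> rat
    & (8 <= k)%N -> ~~ odd k ->
        (gamma_s adj k)%:R <= 3 * k%:R / 8 * #|V|%:R :> rat].
Proof.
have k_gt0 : (0 < k)%N := ltnW k_ge2.
have ratio g num : (8 * g <= num * #|V|)%N -> g%:R <= num%:R / 8 * #|V|%:R :> rat.
  exact: ler_rat_ratio.
have oddE : 3 * k%:R + 1 = (3 * k + 1)%:R :> rat by rewrite natrD natrM.
have evenE : 3 * k%:R = (3 * k)%:R :> rat by rewrite natrM.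
have odd_k : odd k -> exists2 m, (0 < m)%N & k = m.*2.+1.
  by move=> k_odd; exists k./2; clear -k_ge2 k_odd; lia.
have even_k : ~~ odd k -> k = k./2.*2 by clear; lia.
split; [split | split].
- move=> /odd_k[m m_gt0 kE]; rewrite oddE; apply: ratio; apply: gamma_bound => // p q.
  by rewrite kE /= ?uphalf_double ?doubleK; exact: odd_cost.
- move=> /even_k kE; rewrite evenE; apply: ratio; apply: gamma_bound => // p q.
  by rewrite kE uphalf_double; exact: even_cost.
- move=> /odd_k[m m_gt0 kE]; rewrite oddE; apply: ratio; apply: gamma_s_bound => // p q.
  by rewrite kE /= ?uphalf_double ?doubleK; exact: odd_cost.
- move=> k246; have kE : k = k./2.*2 by move: k246; rewrite !inE => /or3P[] /eqP->.
  rewrite -natrM; apply: ler_rat_ratio => //; apply: gamma_s_bound => // p q pq.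
  by left; rewrite kE uphalf_double; exact: roman_cost.
- move=> k8 /even_k kE; rewrite evenE; apply: ratio; apply: gamma_s_bound => // p q.
  rewrite kE uphalf_double doubleK; apply: even_strong_cost.
  by clear -k8; lia.
Qed.
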